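(* For any $k \in \mathbb{N}$ there exists an $n_0$ such that every $k$-graph $H$ on $n \geq n_0$ vertices with \[ \delta_1(H) \geq \left(1 - \frac{1}{22\,(1280k^3)^{k-1}}\right)\binom{n-1}{k-1} \] contains a tight Hamiltonian cycle.
   Context: A $k$-graph $H=(V,E)$ has $E\subseteq\binom{V}{k}$. The degree of a vertex $x$ is the number of edges containing $x$, and $\delta_1(H)$ is the minimum vertex degree. A tight Hamiltonian cycle in a $k$-graph on $n$ vertices is a spanning sub-$k$-graph isomorphic to $([n],E)$ with $E = \{\{i+1, i+2, \ldots, i+k\} : 0 \le i < n\}$, addition modulo $n$ (i.e. a cyclic ordering of all vertices in which every $k$ consecutive vertices form an edge). *)

(* Defs.v *)
From HB Require Import structures.
From mathcomp Require Import all_boot all_order all_algebra.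

Set Implicit Arguments.
Unset Strict Implicit.
Unset Printing Implicit Defensive.

(* The vertex set of a k-graph is the whole finite type T. *)
Record kgraph (k : nat) (T : finType) := KGraph {
  edges :> {set {set T}};
  card_edge : forall e : {set T}, e \in edges -> #|e| = k
}.

Definition degree (k : nat) (T : finType) (H : kgraph k T) (x : T) : nat :=
  #|[set e in edges H | x \in e]|.

(* Every degree is at most #|edges H|, so the initial value of the iterated
   minimum is irrelevant as soon as T is nonempty. *)
Definition min_degree (k : nat) (T : finType) (H : kgraph k T) : nat :=
  \big[minn/#|edges H|]_(x : T) degree H x.

(* Vertices are the residues modulo n; the edges are the sets
   {i + 1, ..., i + k}.  They have exactly k elements when k <= n. *)
Definition tight_cycle (k n : nat) : {set {set 'I_n}} :=
  [set [set j : 'I_n | [exists t : 'I_k, nat_of_ord j == (i + t.+1) %% n]]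
     | i : 'I_n].

Definition isomorphic (T1 T2 : finType)
    (E1 : {set {set T1}}) (E2 : {set {set T2}}) : Prop :=
  exists f : T1 -> T2, bijective f /\ [set f @: e | e : {set T1} in E1] = E2.

(* C has vertex set T, the same as H: it is a spanning sub-k-graph. *)
Definition has_tight_hamiltonian_cycle
    (k : nat) (T : finType) (H : kgraph k T) : Prop :=
  exists C : kgraph k T,
    edges C \subset edges H /\ isomorphic (tight_cycle k #|T|) (edges C).

(* Main.v *)
(* Lopsided local lemma on the space of bijections from Z/n to the vertex set
   (Erdos-Spencer, Lu-Szekely).  The bad events are "the window W is mapped onto
   the k-set e" for e a non-edge; each has probability 1/C(n,k).  Two such events
   interact only if their windows or their k-sets meet, so each event has at most
   about 2k^2 eps C(n,k) neighbours when every vertex misses at most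
   eps C(n-1,k-1) edges.  Since 8 k^2 eps <= 1, some bijection avoids all bad
   events.  Probabilities are replaced by cardinalities throughout. *)
Require Import Defs.
From HB Require Import structures.
From mathcomp Require Import all_boot all_order all_algebra.
From mathcomp Require Import perm.
From mathcomp Require Import zify ring lra.

Set Implicit Arguments.
Unset Strict Implicit.
Unset Printing Implicit Defensive.

Import Order.TTheory GRing.Theory Num.Theory.

(** * Permutations carrying one finite set to another *)

Section PermToSet.
Variable T : finType.

(** Induction on [#|A :\: B|]: transposing a point of [A :\: B] with one of [B :\: A] lowers it and
    moves nothing outside [A :|: B]. *)
Lemma exists_perm_imset (A B : {set T}) : #|A| = #|B| ->
  exists2 s : {perm T}, s @: A = B & forall x, x \notin A :|: B -> s x = x.
Proof.
have [m] := ubnP #|A :\: B|; elim: m A => // m IHm A leAm eqAB.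
have [AB0 | /set0Pn[a aAB]] := eqVneq (A :\: B) set0.
  exists 1%g => [|x _]; last by rewrite perm1.
  have AB : A \subset B by rewrite -setD_eq0 AB0.
  have -> : A = B by apply/eqP; rewrite eqEcard AB eqAB /=.
  by rewrite (eq_imset _ (@perm1 T)) imset_id.
have /card_gt0P[b bBA] : 0 < #|B :\: A|.
  by have := cardsID B A; have := cardsID A B; rewrite setIC (cardsD1 a (A :\: B)) aAB; lia.
move: (aAB) (bBA) leAm; rewrite !inE => /andP[aNB aA] /andP[bNA bB] leAm.
have tA x : (x \in tperm a b @: A) = (tperm a b x \in A).
  by rewrite -{1}(tpermK a b x) mem_imset //; apply: perm_inj.
have [||s sA sE] := IHm (tperm a b @: A).
- suff: #|tperm a b @: A :\: B| < #|A :\: B| by move: leAm; lia.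
  apply: proper_card; apply/properP; split.
    apply/subsetP=> x; rewrite !inE tA => /andP[xNB].
    rewrite xNB /=; case: tpermP => [-> //|xb|//].
    by rewrite xb bB in xNB.
  by exists a => //; rewrite !inE tA tpermL (negbTE bNA) andbF.
- by rewrite card_imset //; apply: perm_inj.
exists (tperm a b * s)%g.
  by rewrite -sA -imset_comp; apply: eq_imset => x; rewrite permM.
move=> x; rewrite inE negb_or => /andP[xNA xNB]; rewrite permM.
have txE : tperm a b x = x.
  by rewrite tpermD //; [apply: contraNneq xNA => <- | apply: contraNneq xNB => <-].
by rewrite txE sE // inE negb_or xNB tA txE xNA.
Qed.

End PermToSet.

(** * Union bound and double counting in set systems of bounded degree *)

Lemma leq_card_bigcup (I T : finType) (A : {set I}) (F : I -> {set T}) :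
  #|\bigcup_(i in A) F i| <= \sum_(i in A) #|F i|.
Proof.
elim/big_rec2: _ => [|i m B _ leBm]; first by rewrite cards0.
by apply: leq_trans (leq_card_setU _ _) _; rewrite leq_add2l.
Qed.

Section Degrees.
Variables (T : finType) (E : {set {set T}}) (D : nat).
Hypothesis degE : forall x, #|[set e in E | x \in e]| <= D.

Lemma card_meeting_edges (A : {set T}) :
  #|[set e in E | ~~ [disjoint e & A]]| <= #|A| * D.
Proof.
apply: (@leq_trans #|\bigcup_(x in A) [set e in E | x \in e]|).
  apply/subset_leq_card/subsetP=> e; rewrite inE => /andP[eE].
  rewrite -setI_eq0 => /set0Pn[x /setIP[xe xA]].
  by apply/bigcupP; exists x => //; rewrite inE eE.
apply: leq_trans (leq_card_bigcup _ _) _.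
by rewrite -sum_nat_const; apply: leq_sum => x _; apply: degE.
Qed.

(** Both sides bound the number of incidences between points and edges. *)
Lemma uniform_card_edges k :
  {in E, forall e : {set T}, #|e| = k} -> k * #|E| <= #|T| * D.
Proof.
move=> cardE; rewrite mulnC -sum_nat_const -(eq_bigr _ cardE).
have -> : \sum_(e in E) #|e| = \sum_(x : T) #|[set e in E | x \in e]|.
  under eq_bigr do rewrite -sum1_card big_mkcond.
  rewrite exchange_big; apply: eq_bigr => x _.
  by rewrite -big_mkcondr sum1dep_card.
by rewrite -sum_nat_const; apply: leq_sum => x _; apply: degE.
Qed.

End Degrees.

(** * The lopsided local lemma for packing two uniform hypergraphs *)

Section Packing.
Variables (P T : finType) (k D1 D2 : nat).
Variables (E1 : {set {set P}}) (E2 : {set {set T}}).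
Hypotheses (card_PT : #|P| = #|T|).
Hypotheses (E1k : {in E1, forall W : {set P}, #|W| = k}).
Hypotheses (E2k : {in E2, forall e : {set T}, #|e| = k}).
Hypotheses (degE1 : forall x, #|[set W in E1 | x \in W]| <= D1).
Hypotheses (degE2 : forall x, #|[set e in E2 | x \in e]| <= D2).

Local Notation event := ({set P} * {set T})%type.

(** Injectivity is enough to describe bijections here, because [P] and [T] have equal size. *)
Definition avoiding (S : {set event}) : {set {ffun P -> T}} :=
  [set f : {ffun P -> T} | injectiveb f & [forall w in S, f @: w.1 != w.2]].

Definition hitting (w : event) (S : {set event}) : {set {ffun P -> T}} :=
  [set f in avoiding S | f @: w.1 == w.2].

Definition conflict (w w' : event) : bool :=
  ~~ [disjoint w'.1 & w.1] || ~~ [disjoint w'.2 & w.2].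

Lemma avoidingP (S : {set event}) (f : {ffun P -> T}) :
  reflect (injective f /\ forall w, w \in S -> f @: w.1 != w.2)
          (f \in avoiding S).
Proof.
rewrite inE; apply: (iffP andP) => [[/injectiveP fI /forall_inP fS]|[fI fS]] //.
by split; [apply/injectiveP | apply/forall_inP].
Qed.

Lemma avoiding_anti (S S' : {set event}) : S \subset S' -> avoiding S' \subset avoiding S.
Proof.
move=> sSS'; apply/subsetP=> f /avoidingP[fI fS].
by apply/avoidingP; split=> // w /(subsetP sSS'); apply: fS.
Qed.

Lemma hitting_anti (w : event) (S S' : {set event}) : S \subset S' -> hitting w S' \subset hitting w S.
Proof.
move=> /avoiding_anti/subsetP sS'S; apply/subsetP=> f.
by rewrite ![f \in hitting _ _]inE => /andP[/sS'S -> ->].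
Qed.

(* Composing with a permutation that carries [e] to [e'] and moves nothing else
   creates no new occurrence of an event disjoint from [(W, e)]. *)
Lemma card_hitting_le (W : {set P}) (e e' : {set T}) (S : {set event}) :
  {in S, forall w, ~~ conflict (W, e) w} -> #|e| = #|e'| ->
  #|hitting (W, e) S| <= #|hitting (W, e') S|.
Proof.
move=> disjS /exists_perm_imset[s se sE].
pose g (f : {ffun P -> T}) := [ffun x => s (f x)] : {ffun P -> T}.
have gI : injective g.
  by move=> f f' /ffunP eqg; apply/ffunP=> x; have := eqg x; rewrite !ffunE => /perm_inj.
rewrite -(card_imset _ gI); apply/subset_leq_card/subsetP=> _ /imsetP[f + ->].
rewrite inE => /andP[/avoidingP[fI fS] /eqP /= fW].
have gfI : injective (g f) by move=> x y; rewrite !ffunE => /perm_inj/fI.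
have gW : g f @: W = e'.
  rewrite -se -fW -imset_comp; apply: eq_imset => x; exact: ffunE.
rewrite inE /= gW eqxx andbT; apply/avoidingP; split=> // w wS.
apply: contra (fS w wS) => /eqP gw.
have := disjS w wS; rewrite negb_or !negbK /= => /andP[dW de].
rewrite -gw; apply/eqP/eq_in_imset => x xw; rewrite ffunE.
have sfx : s (f x) \in w.2 by rewrite -gw; apply/imsetP; exists x; rewrite ?ffunE.
(* By injectivity of [s] it suffices that [s] fixes [s (f x)]. This point lies in [w.2], hence
   outside [e]; it also lies outside [e'], the image of [W] under [g f], because [x] is not in
   [W]. *)
apply/esym/(@perm_inj _ s)/sE; rewrite inE negb_or (disjointFr de sfx) /=.
rewrite -gW; apply/negP=> /imsetP[y yW]; rewrite -(ffunE (fun x => s (f x))) => /gfI xy.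
by move: (disjointFr dW xw); rewrite xy yW.
Qed.

(** The image of [W] splits the avoiding maps into ['C(#|T|, k)] classes, and by [card_hitting_le]
    none is smaller than the class of [e]. *)
Lemma card_hitting_far (w : event) (S : {set event}) : #|w.1| = k -> #|w.2| = k ->
    {in S, forall w', ~~ conflict w w'} ->
  'C(#|T|, k) * #|hitting w S| <= #|avoiding S|.
Proof.
case: w => W e /= cW ce disjS.
rewrite -[#|avoiding S|]sum1_card.
rewrite (partition_big (fun f : {ffun P -> T} => f @: W)
                       [pred e' : {set T} | #|e'| == k]) /=; last first.
  by move=> f /avoidingP[fI _]; rewrite card_imset // cW.
rewrite -card_draws -sum_nat_const.
rewrite [leqLHS](eq_bigl [pred e' : {set T} | #|e'| == k]) => [|e']; last by rewrite inE.
apply: leq_sum => e' /eqP ce'; rewrite sum1dep_card.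
by apply: card_hitting_le; rewrite ?ce.
Qed.

(** At most [k * D1] windows meet [w.1], each paired with any member of [E2], and
    [k * #|E2| <= #|T| * D2]. The count for sets meeting [w.2] is symmetric, hence the factor 2. *)
Lemma card_conflicts (w : event) (S : {set event}) : S \subset setX E1 E2 ->
    #|w.1| = k -> #|w.2| = k ->
  #|[set w' in S | conflict w w']| <= 2 * (#|T| * D1 * D2).
Proof.
move=> /subsetP sS cw1 cw2.
pose M1 := [set W in E1 | ~~ [disjoint W & w.1]].
pose M2 := [set e in E2 | ~~ [disjoint e & w.2]].
have sub : [set w' in S | conflict w w'] \subset setX M1 E2 :|: setX E1 M2.
  apply/subsetP=> w'; rewrite !inE => /andP[/sS]; rewrite inE => /andP[-> ->].
  by rewrite /= andbT.
apply: leq_trans (subset_leq_card sub) _.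
apply: leq_trans (leq_card_setU _ _) _; rewrite !cardsX.
have := card_meeting_edges degE1 w.1; have := card_meeting_edges degE2 w.2.
have := uniform_card_edges degE1 E1k; have := uniform_card_edges degE2 E2k.
rewrite -/M1 -/M2 cw1 cw2 card_PT => h2 h1 m2 m1.
rewrite mul2n -addnn; apply: leq_add.
  apply: leq_trans (leq_mul m1 (leqnn _)) _.
  by rewrite mulnAC (mulnAC #|T|) leq_mul.
apply: leq_trans (leq_mul (leqnn _) m2) _.
by rewrite mulnA leq_mul // mulnC.
Qed.

(** The local lemma condition [4 p d <= 1], with [p] the inverse of ['C(#|T|, k)] and [d] the bound
    of [card_conflicts]. *)
Hypothesis degrees_small : 8 * (#|T| * D1 * D2) <= 'C(#|T|, k).

(* The induction of the lopsided local lemma: the conditional probability of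
   an event, given that [S] is avoided, is at most twice its probability. *)
Lemma card_hitting_avoiding (w : event) (S : {set event}) : S \subset setX E1 E2 ->
    #|w.1| = k -> #|w.2| = k ->
  'C(#|T|, k) * #|hitting w S| <= 2 * #|avoiding S|.
Proof.
have [m] := ubnP #|S|; elim: m w S => // m IHm w S leSm sS cw1 cw2.
pose S1 := [set w' in S | conflict w w'].
pose S2 := [set w' in S | ~~ conflict w w'].
have sS2 : S2 \subset S by apply/subsetP=> w'; rewrite inE => /andP[].
have far : 'C(#|T|, k) * #|hitting w S2| <= #|avoiding S2|.
  by apply: card_hitting_far => // w'; rewrite inE => /andP[].
have leS2 := subset_leq_card (hitting_anti w sS2).
have cS1 : #|S1| <= 2 * (#|T| * D1 * D2) by apply: card_conflicts.
(* Given [far], it remains to see that dropping the conflicting events at most doubles the avoiding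
   set. *)
suff main : #|avoiding S2| <= 2 * #|avoiding S|.
  by apply: leq_trans main; apply: leq_trans far; rewrite leq_mul.
(* A conflicting event makes [S2] strictly smaller than [S], so that the induction hypothesis
   applies to [S2]. *)
have [S10 | /set0Pn[w0 w0S1]] := eqVneq S1 set0.
  suff -> : S2 = S by lia.
  apply/setP=> w'; rewrite inE; have /setP/(_ w') := S10; rewrite !inE.
  by case: (w' \in S) => //= ->.
have ltS2 : #|S2| < #|S|.
  apply: proper_card; apply/properP; split=> //; exists w0.
    by move: w0S1; rewrite inE => /andP[].
  by move: w0S1; rewrite !inE => /andP[-> ->].
have sub : avoiding S2 \subset avoiding S :|: \bigcup_(w' in S1) hitting w' S2.
  apply/subsetP=> f fS2; rewrite inE; apply/orP.
  have [|fNS] := boolP (f \in avoiding S); [by left | right].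
  have [fI fS2'] := avoidingP _ _ fS2.
  have : ~~ [forall w' in S, f @: w'.1 != w'.2].
    by apply: contra fNS => /forall_inP fS; apply/avoidingP.
  rewrite negb_forall_in => /exists_inP[w' w'S]; rewrite negbK => fw'.
  apply/bigcupP; exists w'; last by rewrite inE fS2.
  rewrite inE w'S /=; apply: contraLR fw' => w'N.
  by apply: fS2'; rewrite inE w'S.
have := subset_leq_card sub.
have := leq_card_setU (avoiding S) (\bigcup_(w' in S1) hitting w' S2).
have : 'C(#|T|, k) * #|\bigcup_(w' in S1) hitting w' S2| <= #|S1| * (2 * #|avoiding S2|).
  apply: (@leq_trans ('C(#|T|, k) * \sum_(w' in S1) #|hitting w' S2|)).
    by rewrite leq_mul // leq_card_bigcup.
  rewrite big_distrr -sum_nat_const /=; apply: leq_sum => w'.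
  rewrite inE => /andP[w'S _]; have := subsetP sS _ w'S; rewrite inE => /andP[w1 w2].
  by apply: IHm; rewrite ?E1k ?E2k ?(subset_trans sS2) //; move: leSm ltS2; lia.
(* If the binomial vanishes, [degrees_small] forces [S1] to be empty, contradicting [w0]. *)
have [C0 | C_gt0] := posnP 'C(#|T|, k).
  by move: cS1 degrees_small; rewrite C0 (cardsD1 w0 S1) w0S1; lia.
move=> CU leU le2.
(* With [S1] at most a quarter of the binomial, the union bound [CU] removes at most half of
   [avoiding S2]. *)
have leS1 : 4 * #|S1| <= 'C(#|T|, k) by move: degrees_small cS1; lia.
suff : 2 * #|\bigcup_(w' in S1) hitting w' S2| <= #|avoiding S2| by move: leU.1 le2; lia.
rewrite -(leq_pmul2l C_gt0) mulnCA.
apply: leq_trans (leq_mul (leqnn 2) CU) _.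
by rewrite !mulnA leq_mul //; move: leS1; lia.
Qed.

(** Events are imposed one at a time. Each discards at most a fraction [2 / 'C(#|T|, k)] of the maps
    still left, which is less than all of them. *)
Theorem uniform_hypergraph_packing : 2 < 'C(#|T|, k) ->
  exists2 f : P -> T, bijective f & forall W, W \in E1 -> f @: W \notin E2.
Proof.
move=> C_gt2.
suff /card_gt0P[f /avoidingP[fI fS]] : 0 < #|avoiding (setX E1 E2)|.
  exists f => [|W WE1]; first by apply: inj_card_bij; rewrite ?card_PT.
  by apply/negP=> fWE2; have /eqP[] := fS (W, f @: W) (introT setXP (conj WE1 fWE2)).
suff pos m (S : {set event}) : #|S| = m -> S \subset setX E1 E2 -> 0 < #|avoiding S| by exact: pos.
elim: m S => [|m IHm] S cS sS.
  apply/card_gt0P.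
  exists [ffun x => enum_val (cast_ord card_PT (enum_rank x))].
  apply/avoidingP; split=> [x y|w].
    by rewrite !ffunE => /enum_val_inj/cast_ord_inj/enum_rank_inj.
  by rewrite (cards0_eq cS) inE.
have /card_gt0P[w wS] : 0 < #|S| by rewrite cS.
have sSw : S :\ w \subset setX E1 E2 by apply: subset_trans sS; apply: subsetDl.
have posw : 0 < #|avoiding (S :\ w)|.
  by apply: IHm => //; move: cS; rewrite (cardsD1 w) wS; lia.
have sub : avoiding (S :\ w) \subset avoiding S :|: hitting w (S :\ w).
  apply/subsetP=> f fSw; rewrite inE [f \in hitting _ _]inE fSw /=.
  have [|fw] := boolP (f @: w.1 == w.2); rewrite ?orbT // orbF.
  have [fI fS] := avoidingP _ _ fSw; apply/avoidingP; split=> // w' w'S.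
  by have [-> //|w'w] := eqVneq w' w; apply: fS; rewrite !inE w'w.
have := subset_leq_card sub.
have := (leq_card_setU (avoiding S) (hitting w (S :\ w))).1.
have /setXP[w1 w2] : (w.1, w.2) \in setX E1 E2 by rewrite -surjective_pairing (subsetP sS).
have := card_hitting_avoiding sSw (E1k w1) (E2k w2).
by move: C_gt2 posw; nia.
Qed.

End Packing.

(** * Edge sizes and degrees in the tight cycle *)

Section TightCycle.
Variables k n : nat.
Hypotheses (k_gt0 : 0 < k) (le_kn : k <= n).

Lemma card_tight_cycle_edge (W : {set 'I_n}) : W \in tight_cycle k n -> #|W| = k.
Proof.
case/imsetP=> i _ ->; have n_gt0 : 0 < n by lia.
pose h (t : 'I_k) := Ordinal (ltn_pmod (i + t.+1) n_gt0).
have hI : injective h.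
  move=> s t /(congr1 val)/= /eqP; rewrite eqn_modDl -(addn1 s) -(addn1 t) eqn_modDr.
  by rewrite !modn_small => [/eqP/val_inj| |] //; apply: leq_trans le_kn.
rewrite -[RHS]card_ord -cardsT -(card_imset _ hI); apply: eq_card => j.
rewrite inE; apply/existsP/imsetP => [[t /eqP jt]|[t _ ->]]; exists t => //.
exact: val_inj.
Qed.

(** An edge through [j] is determined by the position of [j] in it, one of [k] possibilities. *)
Lemma tight_cycle_degree (j : 'I_n) : #|[set W in tight_cycle k n | j \in W]| <= k.
Proof.
have n_gt0 : 0 < n by lia.
pose edge (i : 'I_n) : {set 'I_n} :=
  [set j : 'I_n | [exists t : 'I_k, nat_of_ord j == (i + t.+1) %% n]].
(* Adding [n - t.+1] subtracts [t.+1] modulo [n]; there is no truncation since [t < k <= n]. *)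
pose start (t : 'I_k) := Ordinal (ltn_pmod (j + (n - t.+1)) n_gt0).
apply: (@leq_trans #|[set edge (start t) | t : 'I_k]|); last first.
  by apply: leq_trans (leq_imset_card _ _) _; rewrite card_ord.
apply/subset_leq_card/subsetP=> W; rewrite inE => /andP[/imsetP[i _ ->]].
rewrite inE => /existsP[t /eqP jt]; apply/imsetP; exists t => //.
suff <- : i = start t by [].
apply: val_inj; rewrite /= jt modnDml -addnA subnKC ?modnDr ?modn_small //.
exact: leq_trans (ltn_ord t) le_kn.
Qed.

End TightCycle.

(** * Counting [k]-sets and non-edges at a vertex *)

Lemma card_draws_containing (T : finType) k (x : T) : 0 < k ->
  #|[set e : {set T} | #|e| == k & x \in e]| = 'C(#|T| - 1, k - 1).
Proof.
case: k => // k _; rewrite subn1 /= subn1 -(cardsC1 x) -cards_draws.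
have UxI : {in [set A : {set T} | A \subset [set~ x] & #|A| == k] &,
            injective (fun A => x |: A)}.
  move=> A B; rewrite !inE ![_ \subset [set~ x]]subsetC !sub1set !inE.
  move=> /andP[xA _] /andP[xB _].
  by move=> /(congr1 (fun C => C :\ x)); rewrite !setU1K.
rewrite -(card_in_imset UxI); apply: eq_card => e; rewrite inE.
apply/andP/imsetP => [[/eqP ce xe]|[A + ->]].
  exists (e :\ x); last by rewrite setD1K.
  by rewrite inE subsetC sub1set !inE eqxx /=; move: ce; rewrite (cardsD1 x) xe; lia.
rewrite inE subsetC sub1set inE => /andP[xA /eqP cA].
by rewrite cardsU1 xA cA setU11.
Qed.

Lemma leq_bin_self n k : 0 < k < n -> n <= 'C(n, k).
Proof.
elim: n k => [|n IHn] [|k] //=; rewrite ltnS => lt_kn.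
have [<-|ne_kn] := eqVneq k.+1 n; first by rewrite binSn.
have ltSkn : k.+1 < n by lia.
by have := IHn k.+1 ltSkn; have := bin_gt0 n k; rewrite binS; lia.
Qed.

Lemma min_degree_le (k : nat) (T : finType) (H : kgraph k T) x :
  min_degree H <= degree H x.
Proof.
rewrite /min_degree; elim: (index_enum T) (mem_index_enum x) => // y s IHs.
rewrite inE big_cons geq_min => /predU1P[-> |/IHs ->]; by rewrite ?leqnn ?orbT.
Qed.

Section NonEdges.
Variables (k : nat) (T : finType) (H : kgraph k T).

Definition non_edges : {set {set T}} :=
  [set e : {set T} | #|e| == k & e \notin edges H].

Lemma non_edges_degree (x : T) : 0 < k ->
  #|[set e in non_edges | x \in e]| = 'C(#|T| - 1, k - 1) - degree H x.
Proof.
move=> k_gt0; rewrite -(card_draws_containing x k_gt0) /degree.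
set A := [set e in edges H | x \in e]; set B := [set e : {set T} | _ & _].
have sAB : A \subset B.
  by apply/subsetP=> e; rewrite !inE => /andP[/card_edge -> ->]; rewrite eqxx.
rewrite -(setIidPr sAB) -cardsD; apply: eq_card => e; rewrite !inE.
by case: (x \in e); rewrite ?andbF ?andbT // andbC.
Qed.

End NonEdges.

(** * The numerical condition and the conclusion *)

Local Open Scope ring_scope.

(** The local lemma needs only [8 k^2] as the constant. For [k = 1] this reads [8 <= 22]; otherwise
    a single factor [1280 k^3] already exceeds it. *)
Lemma degree_constant_bound (R : realFieldType) (k : nat) : (0 < k)%N ->
  8 * k%:R ^+ 2 <= 22 * (1280 * k%:R ^+ 3) ^+ (k - 1) :> R.
Proof.
case: k => [//|[|k] _]; first by rewrite subnn expr0; lra.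
rewrite subn1 /=.
have k1 : 1 <= k.+2%:R :> R by rewrite ler1n.
set K := k.+2%:R in k1 *.
have K3 : K ^+ 2 <= K ^+ 3 by rewrite ler_weXn2l.
have K2 : 1 <= K ^+ 2 by rewrite exprn_ege1.
have : 1280 * K ^+ 3 <= (1280 * K ^+ 3) ^+ k.+1 by apply: ler_eXnr; [|lra].
lra.
Qed.

Theorem theorem2 (k : nat) (k_gt0 : (0 < k)%N) :
  exists n0 : nat, forall (n : nat) (T : finType) (H : kgraph k T),
    #|T| = n -> (n0 <= n)%N ->
    (1 - 1 / (22 * (1280 * k%:R ^+ 3) ^+ (k - 1))) * 'C(n - 1, k - 1)%:R
      <= (min_degree H)%:R :> rat ->
    has_tight_hamiltonian_cycle H.
Proof.
(* This gives [0 < k < n] and [2 < n], hence [2 < 'C(n, k)] through [leq_bin_self]. *)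
exists (k + 3)%N => n T H cT le_n deg.
have le_kT : (k <= #|T|)%N by lia.
set c := 22 * _ in deg.
have c_ge : 8 * k%:R ^+ 2 <= c := degree_constant_bound rat k_gt0.
clearbody c.
have k1 : 1 <= k%:R :> rat by rewrite ler1n.
have c_gt0 : 0 < c by apply: lt_le_trans c_ge; nra.
(* [D2] bounds the number of non-edges at any vertex. *)
pose D2 := ('C(#|T| - 1, k - 1) - min_degree H)%N.
have [f fB fE] : exists2 f : 'I_#|T| -> T, bijective f &
    forall W, W \in tight_cycle k #|T| -> f @: W \notin non_edges H.
  apply: (@uniform_hypergraph_packing _ _ k k D2); rewrite ?card_ord //.
  - by move=> W; apply: card_tight_cycle_edge.
  - by move=> e; rewrite inE => /andP[/eqP].
  - exact: tight_cycle_degree.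
  - by move=> x; rewrite non_edges_degree // leq_sub2l // min_degree_le.
  - have binE : (#|T| * 'C(#|T| - 1, k - 1) = k * 'C(#|T|, k))%N.
      by have := mul_bin_diag #|T| k.-1; rewrite prednK // !subn1.
    have D2_le : c * D2%:R <= 'C(#|T| - 1, k - 1)%:R.
      have [le|/ltnW le] := leqP 'C(#|T| - 1, k - 1) (min_degree H).
        by rewrite /D2 (eqP le) mulr0.
      rewrite natrB // mulrC -ler_pdivlMr //.
      by move: deg; rewrite -cT mulrBl !mul1r; lra.
    (* Multiplying by [k] and using [binE] leaves a common factor [#|T|]; the rest is
       [8 k^2 D2 <= c D2], followed by [D2_le]. *)
    rewrite -(ler_nat rat) -(ler_pM2l (_ : 0 < k%:R)) ?ltr0n // -[leRHS]natrM -binE !natrM.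
    rewrite [leLHS](_ : _ = #|T|%:R * (8 * k%:R ^+ 2 * D2%:R)); last by ring.
    rewrite ler_wpM2l // (le_trans _ D2_le) // ler_wpM2r //.
  - by apply: (@leq_trans #|T|); [lia | apply: leq_bin_self; lia].
have fI := bij_inj fB.
have cardC e : e \in [set f @: W | W : {set 'I_#|T|} in tight_cycle k #|T|] -> #|e| = k.
  by case/imsetP=> W Wc ->; rewrite card_imset ?(card_tight_cycle_edge k_gt0 le_kT Wc).
exists (KGraph cardC); split; last by exists f.
apply/subsetP=> e eC; have := cardC e eC; case/imsetP: eC => W Wc -> cW.
by have := fE W Wc; rewrite inE cW eqxx negbK.
Qed.
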